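(* $R(\mathcal C_{2k}^{\mathrm{alt}})=O(k^2)$; that is, there is an absolute constant $C$ such that $R(\mathcal C_{2k}^{\mathrm{alt}})\le Ck^2$ for all integers $k\ge 2$, where $\mathcal C_{2k}^{\mathrm{alt}}$ is the alternating cycle on $2k$ vertices.
   Context: An ordered graph is a finite simple graph with a linear ordering of its vertices. An ordered graph $\mathcal H$ is contained in (has a copy in) $\mathcal G$ if there is an order-preserving injection from the vertices of $\mathcal H$ to the vertices of $\mathcal G$ that maps edges to edges. $R(\mathcal G)$ is the minimum $N$ such that every 2-coloring of the edges of the complete ordered graph on $N$ vertices contains a monochromatic copy of $\mathcal G$. The alternating cycle $\mathcal C_{2k}^{\mathrm{alt}}$ is the ordered graph on the $2k$ vertices $a_1<a_2<\dots<a_k<b_k<b_{k-1}<\dots<b_1$ with edge set $\{a_ib_j: |i-j|=1\}\cup\{a_1b_1,\,a_kb_k\}$. *)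

(* Defs.v *)
From mathcomp Require Import all_boot.

Set Implicit Arguments.
Unset Strict Implicit.
Unset Printing Implicit Defensive.

(* The vertex set of an ordered graph is taken to be {0, ..., n-1} with its
   usual order; every finite linearly ordered set is isomorphic to one. *)
Record ograph (n : nat) := OGraph {
  adj : rel 'I_n;
  adj_sym : symmetric adj;
  adj_irr : irreflexive adj
}.

Definition contained m n (H : ograph m) (G : ograph n) : bool :=
  [exists f : {ffun 'I_m -> 'I_n},
    [&& injectiveb f,
        [forall x : 'I_m, forall y : 'I_m, (x <= y) ==> (f x <= f y)]
      & [forall x, forall y, adj H x y ==> adj G (f x) (f y)]]].

(* A 2-colouring of the edges of the complete graph on 'I_N; the values on
   sets that are not of size 2 are never used. *)
Definition coloring N := {ffun {set 'I_N} -> bool}.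

Section ColorClass.
Variables (N : nat) (c : coloring N) (b : bool).

Definition color_adj : rel 'I_N := fun x y => (x != y) && (c [set x; y] == b).

Fact color_adj_sym : symmetric color_adj.
Proof. by move=> x y; rewrite /color_adj eq_sym setUC. Qed.

Fact color_adj_irr : irreflexive color_adj.
Proof. by move=> x; rewrite /color_adj eqxx. Qed.

Definition color_class : ograph N := OGraph color_adj_sym color_adj_irr.

End ColorClass.

Definition ramsey_prop n (G : ograph n) (N : nat) : bool :=
  [forall c : coloring N, exists b : bool, contained G (color_class c b)].

Lemma ramsey_pairwise (p q : nat) : exists N, forall (T : eqType) (c : rel T)
    (s : seq T), N <= size s ->
  exists2 t, subseq t s &
    pairwise c t && (size t == p) ||
    pairwise (fun x y => ~~ c x y) t && (size t == q).
Proof.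
have [m] := ubnP (p + q); elim: m p q => // m IH [|p] [|q] pqm;
  try by exists 0 => T c s _; exists [::]; rewrite ?sub0seq.
have [|N1 H1] := IH p q.+1; first by rewrite -ltnS -addSn.
have [|N2 H2] := IH p.+1 q; first by rewrite -ltnS -addnS.
exists (N1 + N2).+1 => T c [|x s] //=; rewrite ltnS => sz.
have [le1|lt1] := leqP N1 (size (filter (c x) s)).
  have [t sub] := H1 T c _ le1.
  have all_t : all (c x) t.
    by apply/allP => y /(mem_subseq sub); rewrite mem_filter => /andP[].
  have sub' : subseq t s := subseq_trans sub (filter_subseq _ _).
  case/orP => H; last by exists t;
    [exact: subseq_trans sub' (subseq_cons _ _) | rewrite H orbT].
  by exists (x :: t); rewrite /= ?eqxx // all_t /= eqSS H.
have le2 : N2 <= size (filter (predC (c x)) s).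
  rewrite size_filter -(leq_add2l (count (c x) s)) count_predC.
  by apply: leq_trans sz; rewrite leq_add2r -size_filter ltnW.
have [t sub] := H2 T c _ le2.
have all_t : all (fun y => ~~ c x y) t.
  by apply/allP => y /(mem_subseq sub); rewrite mem_filter => /andP[].
have sub' : subseq t s := subseq_trans sub (filter_subseq _ _).
case/orP => H; first by exists t;
  [exact: subseq_trans sub' (subseq_cons _ _) | rewrite H].
by exists (x :: t); rewrite /= ?eqxx // all_t /= !eqSS H orbT.
Qed.

Lemma ramsey_exists n (G : ograph n) : exists N, ramsey_prop G N.
Proof.
have [N HN] := ramsey_pairwise n n; exists N; apply/forallP => c.
have [|t sub Ht] := HN 'I_N (fun x y => c [set x; y]) (enum 'I_N).
  by rewrite size_enum_ord.
have [b /andP[Pt /eqP szt]] : exists b,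
    pairwise (fun x y => c [set x; y] == b) t && (size t == n).
  case/orP: Ht => /andP[Pt ->]; [exists true | exists false]; rewrite andbT.
    by apply: sub_pairwise Pt => x y /= ->.
  by apply: sub_pairwise Pt => x y /= /negbTE->.
have St : pairwise (fun x y : 'I_N => x < y) t.
  apply: (subseq_pairwise sub).
  have : pairwise ltn (map val (enum 'I_N)).
    by rewrite val_enum_ord -sorted_pairwise ?iota_ltn_sorted //; exact: ltn_trans.
  by rewrite pairwise_map.
apply/existsP; exists b; apply/existsP.
pose f := [ffun i : 'I_n => tnth (in_tuple t) (cast_ord (esym szt) i)].
have fP (i j : 'I_n) : i < j -> f i < f j /\ c [set f i; f j] == b.
  move=> ij; pose x0 := f i; rewrite !ffunE !(tnth_nth x0) /=.
  by split; [apply: (pairwiseP x0 St) | apply: (pairwiseP x0 Pt)];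
    rewrite ?inE ?szt.
exists f; apply/and3P; split.
- apply/injectiveP => i j fij; apply/val_inj.
  by case: (ltngtP i j) => // /fP[]; rewrite fij ltnn.
- apply/forallP => i; apply/forallP => j; apply/implyP.
  by rewrite leq_eqVlt => /predU1P[/val_inj -> //|/fP[/ltnW]].
apply/forallP => i; apply/forallP => j; apply/implyP => Gij /=.
rewrite /color_adj; case: (ltngtP i j) => [/fP[lt ->]|/fP[lt]|/val_inj eij].
- by rewrite andbT -val_eqE neq_ltn lt.
- by rewrite setUC => ->; rewrite andbT -val_eqE neq_ltn lt orbT.
- by rewrite eij adj_irr in Gij.
Qed.

Definition ramsey_number n (G : ograph n) : nat := ex_minn (ramsey_exists G).

(* With indices shifted to start at 0, the k + k vertices
   a_0 < ... < a_(k-1) < b_(k-1) < ... < b_0 are numbered from left to right: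
   a_i is the vertex i and b_j is the vertex 2k - 1 - j. *)
Section AlternatingCycle.
Variable k : nat.

Definition alt_a (i : 'I_k) : 'I_(k + k) := lshift k i.
Definition alt_b (j : 'I_k) : 'I_(k + k) := rev_ord (lshift k j).

Definition alt_edge (i j : 'I_k) : bool :=
  [|| i.+1 == j :> nat, j.+1 == i :> nat,
      (i == 0 :> nat) && (j == 0 :> nat)
    | (i == k.-1 :> nat) && (j == k.-1 :> nat)].

Definition alt_adj : rel 'I_(k + k) := fun x y =>
  [exists i : 'I_k, exists j : 'I_k, alt_edge i j &&
    ((x == alt_a i) && (y == alt_b j) || (x == alt_b j) && (y == alt_a i))].

Fact alt_adj_sym : symmetric alt_adj.
Proof.
move=> x y; apply: eq_existsb => i; apply: eq_existsb => j.
by rewrite orbC andbC [(y == _) && _]andbC [X in _ || X]andbC andbC.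
Qed.

Fact alt_adj_irr : irreflexive alt_adj.
Proof.
move=> x; apply/negbTE/existsPn => i; apply/existsPn => j.
have Hab : alt_a i != alt_b j.
  rewrite -val_eqE neq_ltn /= (leq_trans (ltn_ord i)) //.
  by rewrite -addnBA ?leq_addr // ltn_ord.
apply/negP => /andP[_ /orP[]] /andP[/eqP-> e].
  by rewrite e in Hab.
by rewrite eq_sym e in Hab.
Qed.

Definition alt_cycle : ograph (k + k) := OGraph alt_adj_sym alt_adj_irr.

End AlternatingCycle.

(* Main.v *)
Require Import Defs.
From mathcomp Require Import all_boot zify.

(** Split the 2M vertices into a lower half, read as the rows of an M x M array,
    and an upper half, read from right to left as its columns. A pair (row,
    column) is then a cell carrying the colour of the edge between the two
    vertices. In these terms the alternating cycle on 2k vertices is a chain of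
    cells p_1 < ... < p_k, increasing in both coordinates, with p_i = (a_i, b_i):
    the edges a_i b_(i+1) and a_(i+1) b_i are the two other corners of the
    rectangle spanned by p_i and p_(i+1), and a_1 b_1 and a_k b_k are the first
    and the last cell. So it suffices to find, in one colour class E, a chain of
    k cells of E in which the other two corners of consecutive cells are also in
    E ([chain_alt_cycle]); call such a pair of consecutive cells a rung.

    Let E be the more frequent colour, so that E has at least M^2 / 2 cells. A
    subset of E without rungs contains no four corners of a rectangle, because
    the smallest and the largest corner of such a rectangle, in the product
    order, would form a rung ([rung_free_rectangle_free]). By the
    Kovari-Sos-Turan bound ([rectangle_free_card]) it has O(M^(3/2)) cells. The
    rungs form an acyclic digraph on E, and a digraph whose independent sets are
    small has a long path ([long_path_of_small_independent]): here of order
    M^2 / M^(3/2) = M^(1/2). Hence M of order k^2 suffices; M = (4k)^2 makes the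
    constants work. *)

Set Implicit Arguments.
Unset Strict Implicit.
Unset Printing Implicit Defensive.

(** The vertices of [F] with no predecessor in [F] are independent, so discarding
    them costs at most [t] vertices. Each of the [k] rounds of discarding lets
    the path found in what remains be extended by one vertex at its start. *)
Lemma long_path_of_small_independent (T : finType) (e : rel T) (t k : nat)
    (F : {set T}) :
  (forall S : {set T}, S \subset F ->
     (forall x y, x \in S -> y \in S -> ~~ e x y) -> #|S| <= t) ->
  k * t < #|F| ->
  exists s : seq T, [/\ size s = k.+1, sorted e s & {subset s <= F}].
Proof.
elim: k F => [|k IHk] F small big.
  have /card_gt0P[x xF] : 0 < #|F| by [].
  by exists [:: x]; split=> // y; rewrite inE => /eqP->.
pose G := [set x in F | [exists y in F, e y x]].
have sGF : G \subset F by apply/subsetP=> x; rewrite inE => /andP[].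
have smallD : #|F :\: G| <= t.
  apply: small => [|x y]; first exact: subsetDl.
  rewrite !inE => /andP[_ xF] /andP[+ yF]; rewrite yF /=.
  by apply: contra => exy; apply/exists_inP; exists x.
have [S sSG||s [szs es sG]] := IHk G.
- by apply: small; apply: subset_trans sGF.
- have := cardsID G F; rewrite (setIidPr sGF); lia.
case: s szs es sG => // x s szs es sG.
have /[!inE]/andP[_ /exists_inP[y yF eyx]] : x \in G by apply: sG; apply: mem_head.
exists [:: y, x & s]; split; first by rewrite /= -szs.
  by rewrite /= eyx.
by move=> z; rewrite inE => /predU1P[-> //|/sG/(subsetP sGF)].
Qed.

Definition rectangle_free (A B : finType) (S : {set A * B}) :=
  forall x x' y y', x != x' -> y != y' ->
  ~~ [&& (x, y) \in S, (x, y') \in S, (x', y) \in S & (x', y') \in S].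

Lemma card_sum_rows (A B : finType) (S : {set A * B}) :
  #|S| = \sum_x \sum_y ((x, y) \in S).
Proof.
rewrite pair_bigA /= -sum1_card big_mkcond /=.
by apply: eq_bigr => -[x y] _ /=; case: (_ \in S).
Qed.

(** Double counting of the triples formed by a row and an ordered pair of cells
    of [S] in it: two distinct columns have at most one row in common, and the
    pairs with equal columns contribute [#|S|] in total. *)
Lemma rectangle_free_sum_sqr (A B : finType) (S : {set A * B}) :
  rectangle_free S ->
  \sum_x (\sum_y ((x, y) \in S)) ^ 2 <= #|B| ^ 2 + #|S|.
Proof.
move=> freeS.
have -> : \sum_x (\sum_y ((x, y) \in S)) ^ 2 =
    \sum_y \sum_y' \sum_x ((x, y) \in S) * ((x, y') \in S).
  rewrite (eq_bigr (fun x => \sum_y \sum_y' ((x, y) \in S) * ((x, y') \in S))).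
    by rewrite exchange_big; apply: eq_bigr => y _; rewrite exchange_big.
  move=> x _; rewrite -mulnn big_distrl; apply: eq_bigr => y _.
  by rewrite big_distrr.
have -> : #|B| ^ 2 + #|S| =
    \sum_(y : B) \sum_(y' : B) (1 + (y == y') * \sum_x ((x, y) \in S)).
  rewrite card_sum_rows exchange_big -sum1_card -mulnn big_distrl -big_split /=.
  apply: eq_bigr => y _; rewrite big_split /= mul1n; congr (_ + _).
  rewrite (bigD1 y) //= eqxx mul1n [X in _ = _ + X]big1 ?addn0 //.
  by move=> y' /negbTE; rewrite eq_sym => ->.
apply: leq_sum => y _; apply: leq_sum => y' _.
have [<-|neq_y] := eqVneq y y'.
  by rewrite mul1n ltnW // add1n ltnS; apply: leq_sum => x _; case: (_ \in S).
rewrite mul0n addn0.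
(* Once a row [x] meets [S] in both columns, no other row does. *)
have [x /andP[xy xy']|none] := pickP (fun x => ((x, y) \in S) && ((x, y') \in S)).
  rewrite (bigD1 x) //= xy xy' big1 // => x' neq_x.
  have := freeS x x' y y'; rewrite eq_sym neq_x neq_y xy xy' => /(_ isT isT).
  by case: (_ \in S); case: (_ \in S).
rewrite big1 // => x _; have := none x.
by case: (_ \in S); case: (_ \in S).
Qed.

(** The Kovari-Sos-Turan bound for forbidden rectangles. A square number of rows
    and columns makes the bound integral, and lets the convexity step be the
    inequality 2 L d <= L^2 + d^2 applied to each row sum d. *)
Lemma rectangle_free_card (A B : finType) (S : {set A * B}) (L : nat) :
  #|A| = L ^ 2 -> #|B| = L ^ 2 -> rectangle_free S -> #|S| <= 2 * L ^ 3.
Proof.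
move=> cardA cardB /rectangle_free_sum_sqr; rewrite cardB => sum_sqr.
have amgm : 2 * L * #|S| <=
    \sum_x (\sum_y ((x, y) \in S)) ^ 2 + L ^ 2 * L ^ 2.
  have <- : \sum_(x : A) L ^ 2 = L ^ 2 * L ^ 2 by rewrite sum_nat_const cardA.
  rewrite -big_split card_sum_rows big_distrr /=; apply: leq_sum => x _.
  by rewrite addnC -mulnA nat_Cauchy.
(* Cancelling L leaves (2 L - 1) #|S| <= 2 L^4, and 2 L - 1 >= L unless L = 0. *)
case: L => [|L] in cardA cardB sum_sqr amgm *; last by nia.
by move: (max_card (mem S)); rewrite card_prod cardA.
Qed.

(** For consecutive cells p = (a_i, b_i) and q = (a_(i+1), b_(i+1)) of a chain,
    the two corners in [E] are the edges a_i b_(i+1) and a_(i+1) b_i of the cycle. *)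
Definition rung M (E : {set 'I_M * 'I_M}) : rel ('I_M * 'I_M) := fun p q =>
  [&& p.1 < q.1, p.2 < q.2, (p.1, q.2) \in E & (q.1, p.2) \in E].

(** Of the four corners of a rectangle in [S], the smallest and the largest one
    form a rung, since the other two corners lie in [S] and hence in [E]. *)
Lemma rung_free_rectangle_free M (E S : {set 'I_M * 'I_M}) :
  S \subset E -> (forall p q, p \in S -> q \in S -> ~~ rung E p q) ->
  rectangle_free S.
Proof.
move=> /subsetP sSE free x x' y y' nx ny; apply/and4P => -[xy xy' x'y x'y'].
have no_rectangle (a a' b b' : 'I_M) : a < a' -> b < b' -> (a, b) \in S ->
    (a, b') \in S -> (a', b) \in S -> (a', b') \in S -> False.
  move=> la lb ab ab' a'b a'b'; have := free _ _ ab a'b'.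
  by rewrite /rung /= la lb !sSE.
have {}nx : x != x' :> nat by [].
have {}ny : y != y' :> nat by [].
by case: (ltngtP x x') nx => // lx _; case: (ltngtP y y') ny => // ly _;
  apply: (no_rectangle _ _ _ _ lx ly).
Qed.

Lemma alt_vertexP k (x : 'I_(k + k)) :
  (exists i, x = alt_a i) \/ (exists j, x = alt_b j).
Proof.
case: (splitP x) => i xi; [left; exists i | right; exists (rev_ord i)].
  exact: val_inj.
by apply: val_inj; rewrite /= xi; have := ltn_ord i; lia.
Qed.

Definition cell_color M (c : coloring (M + M)) (b : bool) : {set 'I_M * 'I_M} :=
  [set p | c [set alt_a p.1; alt_b p.2] == b].

Lemma majority_color M (c : coloring (M + M)) :
  exists b, M ^ 2 <= 2 * #|cell_color c b|.
Proof.
have : #|cell_color c true| + #|cell_color c false| = M ^ 2.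
  have <- : ~: cell_color c true = cell_color c false.
    by apply/setP=> p; rewrite !inE; case: (c _).
  by rewrite cardsC card_prod card_ord.
have [le_tf|/ltnW le_ft] := leqP #|cell_color c true| #|cell_color c false|.
  by exists false; lia.
by exists true; lia.
Qed.

(** The row and column of the i-th cell serve as the images of a_i and b_i. The
    columns are numbered from right to left, as the b_i are, so the chain being
    increasing in both coordinates makes this map increasing. *)
Lemma chain_alt_cycle k M (c : coloring (M + M)) b (s : seq ('I_M * 'I_M)) :
  size s = k -> sorted (rung (cell_color c b)) s ->
  {subset s <= cell_color c b} ->
  contained (alt_cycle k) (color_class c b).
Proof.
move=> szs rs sE.
case: k => [|k] in szs *.
  apply/existsP; exists [ffun x : 'I_(0 + 0) => False_rect _ (notF (ltn_ord x))].
  by apply/and3P; split; [apply/injectiveP|apply/forallP|apply/forallP] => -[].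
have p0 : 'I_M * 'I_M by case: s szs {rs sE}.
pose p i := nth p0 s i.
have mono (i j : nat) : i < j -> j < k.+1 ->
    (p i).1 < (p j).1 /\ (p i).2 < (p j).2.
  move=> ij jk.
  pose lt2 (q r : 'I_M * 'I_M) := (q.1 < r.1) && (q.2 < r.2).
  have lt2_tr : transitive lt2.
    move=> q r u /andP[r1 r2] /andP[q1 q2].
    by rewrite /lt2 (ltn_trans r1 q1) (ltn_trans r2 q2).
  have s2 : sorted lt2 s.
    by apply: sub_sorted rs => q r /and4P[q1 q2 _ _]; rewrite /lt2 q1.
  apply/andP; apply: (sorted_ltn_nth lt2_tr p0 s2) => //;
    by rewrite inE szs ?(ltn_trans ij).
pose g (x : 'I_(k.+1 + k.+1)) : 'I_(M + M) :=
  match split x with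
  | inl i => alt_a (p i).1
  | inr j => alt_b (p (rev_ord j)).2
  end.
have ga i : g (alt_a i) = alt_a (p i).1.
  by rewrite /g -[alt_a i]/(unsplit (inl i)) unsplitK.
have gb j : g (alt_b j) = alt_b (p j).2.
  have -> : alt_b j = rshift k.+1 (rev_ord j).
    by apply: val_inj => /=; have := ltn_ord j; lia.
  by rewrite /g -[rshift _ _]/(unsplit (inr _)) unsplitK rev_ordK.
have g_lt (x y : 'I_(k.+1 + k.+1)) : x < y -> g x < g y.
  have [[i ->]|[i ->]] := alt_vertexP x; have [[j ->]|[j ->]] := alt_vertexP y;
    rewrite ?ga ?gb /= => lt_xy.
  - by have [] := mono _ _ lt_xy (ltn_ord j).
  - by have := ltn_ord (p i).1; have := ltn_ord (p j).2; lia.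
  - by have := ltn_ord i; have := ltn_ord j; lia.
  - have ji : j < i by lia.
    have [_] := mono _ _ ji (ltn_ord i).
    by have := ltn_ord (p i).2; lia.
have edge (i j : 'I_k.+1) : alt_edge i j -> ((p i).1, (p j).2) \in cell_color c b.
  have step l : l.+1 < k.+1 -> rung (cell_color c b) (p l) (p l.+1).
    by move=> lk; apply: (sortedP p0 rs); rewrite szs.
  have cell (l : 'I_k.+1) : ((p l).1, (p l).2) \in cell_color c b.
    by rewrite -surjective_pairing; apply/sE/mem_nth; rewrite szs.
  case/or4P=> [/eqP ij|/eqP ji|/andP[/eqP i0 /eqP j0]|/andP[/eqP i0 /eqP j0]].
  - by have := step i; rewrite ij => /(_ (ltn_ord j))/and4P[].
  - by have := step j; rewrite ji => /(_ (ltn_ord i))/and4P[].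
  - by rewrite (_ : i = j) //; apply: val_inj; rewrite /= i0 j0.
  - by rewrite (_ : i = j) //; apply: val_inj; rewrite /= i0 j0.
have adjg (i j : 'I_k.+1) : alt_edge i j ->
    color_adj c b (g (alt_a i)) (g (alt_b j)).
  move=> /edge; rewrite inE /= ga gb /color_adj => ->; rewrite andbT.
  rewrite -val_eqE /=; have := ltn_ord (p i).1; have := ltn_ord (p j).2; lia.
apply/existsP; exists [ffun x => g x]; apply/and3P; split.
- apply/injectiveP => x y; rewrite !ffunE => gxy; apply: val_inj.
  by case: (ltngtP x y) => // /g_lt; rewrite gxy ltnn.
- apply/forallP => x; apply/forallP => y; apply/implyP; rewrite !ffunE.
  by rewrite leq_eqVlt => /predU1P[/val_inj->|/g_lt/ltnW].
apply/forallP => x; apply/forallP => y; apply/implyP; rewrite !ffunE.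
move=> /existsP[i /existsP[j /andP[/adjg ij]]].
by case/orP => /andP[/eqP-> /eqP->] //=; rewrite color_adj_sym.
Qed.

(** With L = 4k and L^2 rows, the majority colour has at least L^4 / 2 = 2k L^3
    cells, which exceeds k - 1 times the bound 2 L^3 on the size of a rung-free
    set. *)
Lemma ramsey_alt_cycle k : 0 < k ->
  ramsey_prop (alt_cycle k) ((4 * k) ^ 2 + (4 * k) ^ 2).
Proof.
move=> k0; apply/forallP => c; have [b big] := majority_color c.
apply/existsP; exists b.
set E := cell_color c b in big *; set L := 4 * k in c E big *.
have [S sSE free||s [szs rs sE]] :=
  @long_path_of_small_independent _ (rung E) (2 * L ^ 3) k.-1 E.
- apply: (rectangle_free_card _ _ (rung_free_rectangle_free sSE free));
    by rewrite card_ord.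
- have : 0 < L ^ 3 by rewrite expn_gt0 /L; lia.
  move: big; rewrite -expnM (expnS L 3) {1}/L -mulnA => big X0.
  rewrite -(ltn_pmul2l (isT : 0 < 2)); apply: leq_trans big.
  by rewrite !mulnA ltn_pmul2r //; lia.
by apply: chain_alt_cycle rs sE; rewrite szs prednK.
Qed.

Theorem theorem24 :
  exists C : nat, forall k : nat, 2 <= k ->
    ramsey_number (alt_cycle k) <= C * k ^ 2.
Proof.
exists 32 => k k2; rewrite /ramsey_number; case: ex_minnP => m _ min_m.
apply: leq_trans (min_m _ (ramsey_alt_cycle (ltnW k2))) _.
by rewrite expnMn -mulnDl.
Qed.
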